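(* Let $\delta \geq 2$ be an integer and let $G$ be a connected graph of order $n \geq \max\{9\delta, \frac{\delta^2}{2}+3\delta+3\}$ with minimum degree $\delta$. If $\lambda_1(D(G)) \leq \lambda_1\big(D(K_\delta \vee (K_{n-2\delta-1} \cup (\delta+1)K_1))\big)$, then $G$ is a $1$-tough graph, unless $G \cong K_\delta \vee (K_{n-2\delta-1} \cup (\delta+1)K_1)$.
   Context: All graphs are finite and simple. For a connected graph $G$ with vertex set $\{v_1,\dots,v_n\}$, the distance matrix $D(G)$ is the $n\times n$ matrix whose $(i,j)$-entry is the length of a shortest path between $v_i$ and $v_j$; $\lambda_1(D(G))$ denotes its largest eigenvalue (the distance spectral radius). For a graph $G$ and $S\subseteq V(G)$, $G-S$ is the subgraph induced by $V(G)\setminus S$ and $c(G-S)$ is its number of connected components. For a connected non-complete graph $G$, $\tau(G)=\min\left\{\frac{|S|}{c(G-S)-1} : S\subset V(G),\ c(G-S)>1\right\}$; $G$ is called $\tau$-tough if $\tau(G)\geq \tau$ (a graph admitting no $S$ with $c(G-S)>1$, e.g. a complete graph, is regarded as $\tau$-tough). $K_m$ is the complete graph on $m$ vertices, $tK_1$ is the edgeless graph on $t$ vertices, $G_1\cup G_2$ is the disjoint union, and $G_1\vee G_2$ (the join) is obtained from $G_1\cup G_2$ by adding all edges between $V(G_1)$ and $V(G_2)$. *)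

(* Defs.v *)
From HB Require Import structures.
From mathcomp Require Import all_boot all_order all_algebra.
From mathcomp Require Import boolp classical_sets reals.

Set Implicit Arguments.
Unset Strict Implicit.
Unset Printing Implicit Defensive.

Import Order.TTheory GRing.Theory Num.Theory.

Record sgraph := SGraph {
  vertex :> finType;
  adj : rel vertex;
  adj_sym : symmetric adj;
  adj_irr : irreflexive adj }.

Definition graph_iso (G H : sgraph) : Prop :=
  exists2 f : G -> H, bijective f & forall x y, adj (f x) (f y) = adj x y.

Definition connected (G : sgraph) : Prop :=
  forall x y : G, connect (@adj G) x y.

Definition degree (G : sgraph) (x : G) : nat := #|[set y | adj x y]|.

(* Every degree is smaller than #|G|, so the default value is harmless as soon
   as G has a vertex. *)
Definition min_degree (G : sgraph) : nat :=
  \big[minn/#|G|]_(x : G) degree x.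

Definition has_path (G : sgraph) (x y : G) (k : nat) : bool :=
  [exists p : k.-tuple G,
    [&& path (@adj G) x p, uniq (x :: p) & last x p == y]].

(* A path has at most #|G| - 1 edges; the value is #|G| if x and y lie in
   different components. *)
Definition dist (G : sgraph) (x y : G) : nat :=
  find (has_path x y) (iota 0 #|G|).

Definition distance_matrix (R : realType) (G : sgraph) : 'M[R]_#|G| :=
  (\matrix_(i, j) (dist (enum_val i) (enum_val j))%:R)%R.

(* The largest eigenvalue; 0 by convention if there is none, which cannot happen
   for a symmetric real matrix with at least one row. *)
Definition lambda1 (R : realType) (m : nat) (A : 'M[R]_m) : R :=
  xget 0%R [set a : R | eigenvalue A a /\
                        (forall b : R, eigenvalue A b -> b <= a)%R]%classic.

Section Deletion.
Variables (G : sgraph) (S : {set G}).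

Definition del_rel : rel {x : G | x \notin S} :=
  fun x y => adj (val x) (val y).

Lemma del_sym : symmetric del_rel.
Proof. by move=> x y; apply: adj_sym. Qed.

Lemma del_irr : irreflexive del_rel.
Proof. by move=> x; apply: adj_irr. Qed.

Definition del_vertices : sgraph := SGraph del_sym del_irr.

End Deletion.

Definition num_components (G : sgraph) : nat := n_comp (@adj G) predT.

Definition separating (G : sgraph) : {set {set G}} :=
  [set S : {set G} | 1 < num_components (del_vertices S)].

Definition tough_ratio (G : sgraph) (S : {set G}) : rat :=
  (#|S|%:R / ((num_components (del_vertices S))%:R - 1))%R.

(* None when no vertex set separates G. *)
Definition toughness (G : sgraph) : option rat :=
  if [pick S in separating G] is Some S0 then
    Some (tough_ratio [arg min_(S < S0 in separating G) tough_ratio S]%O)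
  else None.

Definition tough (t : rat) (G : sgraph) : Prop :=
  if toughness G is Some u then (t <= u)%R else True.

Section Complete.
Variable m : nat.

Definition complete_rel : rel 'I_m := fun x y => x != y.

Lemma complete_sym : symmetric complete_rel.
Proof. by move=> x y; rewrite /complete_rel eq_sym. Qed.

Lemma complete_irr : irreflexive complete_rel.
Proof. by move=> x; rewrite /complete_rel eqxx. Qed.

Definition complete_graph : sgraph := SGraph complete_sym complete_irr.

Definition edgeless_rel : rel 'I_m := fun _ _ => false.

Lemma edgeless_sym : symmetric edgeless_rel.
Proof. by []. Qed.

Lemma edgeless_irr : irreflexive edgeless_rel.
Proof. by []. Qed.

Definition edgeless_graph : sgraph := SGraph edgeless_sym edgeless_irr.

End Complete.

Section UnionJoin.
Variables G H : sgraph.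

(* cross says whether the two parts are completely joined. *)
Definition sum_rel (cross : bool) : rel (G + H)%type := fun u v =>
  match u, v with
  | inl x, inl y => adj x y
  | inr x, inr y => adj x y
  | _, _ => cross
  end.

Lemma sum_sym cross : symmetric (sum_rel cross).
Proof. by move=> [x|x] [y|y] //=; apply: adj_sym. Qed.

Lemma sum_irr cross : irreflexive (sum_rel cross).
Proof. by move=> [x|x] /=; apply: adj_irr. Qed.

Definition disjoint_union : sgraph := SGraph (sum_sym false) (sum_irr false).

Definition join_graph : sgraph := SGraph (sum_sym true) (sum_irr true).

End UnionJoin.

(* K_d v (K_(n-2d-1) U (d+1) K_1), of order n provided 2d + 1 <= n. *)
Definition extremal_graph (n d : nat) : sgraph :=
  join_graph (complete_graph d)
    (disjoint_union (complete_graph (n - 2 * d - 1)) (edgeless_graph d.+1)).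

(* Main.v *)
(** If G is not 1-tough, some vertex set S, of size s, leaves at least s + 2
    components. Every distance between distinct vertices is at least 1, and at
    least 2 for non-adjacent ones, so for a nonnegative vector y the Rayleigh
    quotient gives
      (sum y)^2 + sum_(u, v non-adjacent) y_u y_v <= (lambda_1(D(G)) + 1) |y|^2.
    Let mu be the root of the cubic [quotient_poly] for the extremal graph, so
    that lambda_1(D) <= mu - 1 for the extremal graph by a positive eigenvector.
    - If s >= delta, take y constant on S, on one representative of each of s + 1
      components other than the largest one, and on the remaining vertices, the
      three values being read off the quotient equations of
      K_s v (K_(n-2s-1) U (s+1) K_1) at mu. The quotient exceeds mu unless
      s = delta and G is the extremal graph.
    - If s < delta, each component has at least delta - s + 1 vertices, and the
      vector equal to 2 outside S and the largest component, and 1 elsewhere, has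
      a quotient larger than mu. *)

Require Import Defs.
From mathcomp Require Import all_boot all_order all_algebra.
From mathcomp Require Import reals.
From mathcomp Require Import complex sesquilinear spectral.
From mathcomp Require boolp classical_sets.
From mathcomp Require Import zify ring lra.

Set Implicit Arguments.
Unset Strict Implicit.
Unset Printing Implicit Defensive.

Import Order.TTheory GRing.Theory Num.Theory.

Local Open Scope ring_scope.

(** * Rayleigh and positive-vector bounds for [lambda1] *)

Section LargestEigenvalue.
Local Open Scope sesquilinear_scope.
Variable R : realType.

(** Over the complex numbers [A] is Hermitian, hence unitarily diagonalisable with a real spectrum.
    In the coordinates [z] both forms become weighted sums of squared moduli, and the largest
    diagonal entry serves as [a]. *)
Lemma symmetric_max_eigenvalue (m : nat) (A : 'M[R]_m) :
    (0 < m)%N -> A^T = A ->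
  exists2 a, eigenvalue A a &
    forall x : 'rV_m, (x *m A *m x^T) 0 0 <= a * (x *m x^T) 0 0.
Proof.
move=> m_gt0 A_sym; pose i0 : 'I_m := Ordinal m_gt0.
pose AC := map_mx (real_complex R) A.
have AC_herm : AC \is hermsymmx.
  apply: realsym_hermsym.
    by rewrite qualifE /= expr0 scale1r map_mx_id // map_trmx A_sym eqxx.
  by apply/mxOverP => i j; rewrite mxE complex_real.
have AC_normal := hermitian_normalmx AC_herm.
have := orthomx_spectralP AC_normal.
set P := spectralmx AC; set D := spectral_diag AC => AC_E.
have D_real i : D 0 i \is Num.real.
  by have /mxOverP := hermitian_spectral_diag_real AC_herm; apply.
have P_unitary : P \is unitarymx by apply: spectral_unitarymx.
have [i1 _ i1_max] := @Order.TotalTheory.arg_maxP _ _ _ i0 xpredT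
  (fun i => complex.Re (D 0 i)) isT.
have D_E i : D 0 i = (complex.Re (D 0 i))%:C%C.
  by rewrite RRe_real.
exists (complex.Re (D 0 i1)).
  rewrite -(eigenvalue_map (real_complex R)) /= -D_E.
  apply/eigenvalueP; exists (row i1 P).
    rewrite -/AC [in LHS]AC_E !mulmxA -row_mul mulmxV ?unitarymx_unit //.
    rewrite -row_mul mul1mx; apply/rowP => j; rewrite !mxE.
    rewrite (bigD1 i1) //= big1 ?addr0 => [|l l_neq].
      by rewrite !mxE eqxx mulr1n.
    by rewrite !mxE eq_sym (negPf l_neq) mul0r.
  apply/eqP => row0; have /row_unitarymxP/(_ i1 i1) := P_unitary.
  by rewrite row0 linear0l eqxx => /eqP; rewrite eq_sym oner_eq0.
move=> x; pose xC := map_mx (real_complex R) x; pose z := xC *m P^t*.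
have PP1 : P^t* *m P = 1%:M.
  by rewrite -invmx_unitary // mulVmx // unitarymx_unit.
have xCt : xC^t* = xC^T.
  by apply/matrixP => i j; rewrite !mxE; rewrite conj_Creal ?complex_real.
have zt : z^t* = P *m xC^T.
  by rewrite trmx_mul map_mxM xCt; congr (_ *m _); apply: trmxCK.
have zE (d : 'rV_m) :
    (z *m diag_mx d *m z^t*) 0 0 = \sum_i d 0 i * (z 0 i * (z 0 i)^* ).
  rewrite mxE; apply: eq_bigr => i _; rewrite mul_mx_diag !mxE.
  by rewrite mulrCA mulrA.
rewrite -lecR rmorphM /=.
have -> : ((x *m A *m x^T) 0 0)%:C%C = (z *m diag_mx D *m z^t*) 0 0.
  rewrite zt /z -invmx_unitary // !mulmxA -(mulmxA xC) -(mulmxA xC) -AC_E.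
  by rewrite map_trmx -!map_mxM [RHS]mxE.
have -> : ((x *m x^T) 0 0)%:C%C = (z *m diag_mx (const_mx 1) *m z^t*) 0 0.
  rewrite diag_const_mx mulmx1 zt /z mulmxA -(mulmxA xC) PP1 mulmx1.
  by rewrite map_trmx -!map_mxM [RHS]mxE.
rewrite !zE mulr_sumr; apply: ler_sum => i _.
rewrite [const_mx _ _ _]mxE mul1r ler_wpM2r ?mul_conjC_ge0 //.
by rewrite D_E lecR; apply: i1_max.
Qed.

(** Evaluating the Rayleigh bound at eigenvectors shows that [a] dominates every eigenvalue, so it
    is the value that [xget] selects. *)
Lemma lambda1_ge (m : nat) (A : 'M[R]_m) (x : 'rV_m) :
    (0 < m)%N -> A^T = A ->
  (x *m A *m x^T) 0 0 <= lambda1 A * (x *m x^T) 0 0.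
Proof.
move=> m_gt0 A_sym; have [a Aa a_max] := symmetric_max_eigenvalue m_gt0 A_sym.
suff -> : lambda1 A = a by [].
have sqr_gt0 (v : 'rV[R]_m) : v != 0 -> 0 < (v *m v^T) 0 0.
  move=> v_neq0; rewrite mxE lt_def psumr_eq0 => [|i _]; last first.
    by rewrite mxE -expr2 sqr_ge0.
  rewrite sumr_ge0 ?andbT => [|i _]; last by rewrite mxE -expr2 sqr_ge0.
  apply: contra v_neq0 => /allP v0; apply/eqP/rowP => i.
  by have := v0 i (mem_index_enum _); rewrite !mxE mulf_eq0 orbb => /eqP.
have a_ub b : eigenvalue A b -> b <= a.
  case/eigenvalueP => v vA v_neq0.
  by have := a_max v; rewrite vA -scalemxAl mxE ler_pM2r ?sqr_gt0.
rewrite /lambda1; case: classical_sets.xgetP => [_ -> [Ab b_ub]|/(_ a) []//].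
by apply/le_anti; rewrite a_ub // b_ub.
Qed.

(** Collatz-Wielandt argument: for an eigenvector [v], compare both sides of its equation at the
    index maximising [|v_i| / y_i]. The default value 0 of [lambda1] is covered by [0 <= rho]. *)
Lemma lambda1_le (m : nat) (A : 'M[R]_m) (y : 'I_m -> R) (rho : R) :
    0 <= rho -> (forall i j, 0 <= A i j) -> (forall i, 0 < y i) ->
    (forall j, \sum_i y i * A i j <= rho * y j) ->
  lambda1 A <= rho.
Proof.
move=> rho_ge0 A_ge0 y_gt0 yA.
rewrite /lambda1.
case: classical_sets.xgetP => [b _ [/eigenvalueP[v vA v_neq0] _]|//].
have [i0 vi0] : exists i, v 0 i != 0.
  by apply/existsP; apply: contra_neqT v_neq0 => /existsPn v0; apply/rowP => i;
    rewrite mxE; apply/eqP; have := v0 i; rewrite negbK.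
have [j _ j_max] := @Order.TotalTheory.arg_maxP _ _ _ i0 xpredT
  (fun i => `|v 0 i| / y i) isT.
pose M := `|v 0 j| / y j.
have vM i : `|v 0 i| <= M * y i by rewrite -ler_pdivrMr //; apply: j_max.
have M_gt0 : 0 < M.
  apply: lt_le_trans (j_max i0 isT).
  by rewrite divr_gt0 ?normr_gt0.
have vj : `|v 0 j| = M * y j by rewrite /M divfK // gt_eqF.
have: `|b| * `|v 0 j| <= rho * `|v 0 j|.
  rewrite -normrM; have /rowP/(_ j) := vA; rewrite !mxE => <-.
  apply: le_trans (ler_norm_sum _ _ _) _.
  apply: le_trans (_ : \sum_i M * (y i * A i j) <= _).
    apply: ler_sum => i _; rewrite normrM (ger0_norm (A_ge0 i j)) mulrA.
    by rewrite ler_wpM2r.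
  by rewrite -mulr_sumr vj mulrCA ler_pM2l.
rewrite ler_pM2r; last by rewrite vj mulr_gt0.
exact: le_trans (ler_norm _).
Qed.

End LargestEigenvalue.

(** * Distances and the distance spectral radius *)

Section Distance.
Variable G : sgraph.
Implicit Types x y : G.

Definition nonadj x y := (x != y) && ~~ adj x y.

Lemma has_pathP x y k :
  reflect (exists p : k.-tuple G,
             [/\ path (@adj G) x p, uniq (x :: p) & last x p = y])
    (has_path x y k).
Proof.
apply: (iffP (@existsP _ _)) => -[p].
  by case/and3P => xp uniq_p /eqP last_p; exists p.
by case=> xp uniq_p last_p; exists p; rewrite xp uniq_p last_p eqxx.
Qed.

Lemma has_pathC x y k : has_path x y k = has_path y x k.
Proof.
suff imp : forall u v : G, has_path u v k -> has_path v u k.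
  by apply/idP/idP; apply: imp.
move=> u v /has_pathP[p [up uniq_p last_p]]; apply/has_pathP.
have sz_p : size (rev (belast u p)) == k.
  by rewrite size_rev size_belast size_tuple.
have revE : v :: rev (belast u p) = rev (u :: p).
  by rewrite (lastI u) last_p rev_rcons.
exists (Tuple sz_p); split.
- rewrite /= -last_p rev_path (eq_path (e' := @adj G)) // => a b.
  exact: adj_sym.
- by rewrite revE rev_uniq.
- by rewrite /= -(last_cons v) revE rev_cons last_rcons.
Qed.

Lemma distC x y : dist x y = dist y x.
Proof. by apply: eq_find => k; apply: has_pathC. Qed.

Lemma dist_le x y k : has_path x y k -> (dist x y <= k)%N.
Proof.
move=> xy; rewrite leqNgt; apply/negP => k_lt.
have := before_find 0%N k_lt; rewrite nth_iota ?xy //.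
by apply: leq_trans k_lt _; rewrite /dist -[X in (_ <= X)%N](size_iota 0) find_size.
Qed.

Lemma dist_has_path x y : (dist x y < #|G|)%N -> has_path x y (dist x y).
Proof.
move=> lt_d; have := @nth_find _ 0%N (has_path x y) (iota 0 #|G|).
by rewrite -/(dist x y) nth_iota // has_find size_iota => /(_ lt_d).
Qed.

Lemma dist_gt0 x y : x != y -> (0 < dist x y)%N.
Proof.
move=> x_neq_y; rewrite lt0n; apply/eqP => d0; have := dist_has_path (x := x) (y := y).
rewrite d0 => /(_ _)/has_pathP[|p]; first by apply/card_gt0P; exists x.
by rewrite tuple0 /= => -[_ _ /eqP]; rewrite (negPf x_neq_y).
Qed.

Lemma dist_gt1 x y : nonadj x y -> (1 < dist x y)%N.
Proof.
case/andP => x_neq_y nadj_xy; rewrite ltn_neqAle dist_gt0 // andbT eq_sym.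
apply/eqP => d1; have := dist_has_path (x := x) (y := y).
rewrite d1 => /(_ _)/has_pathP[|p].
  by rewrite (cardD1 x) (cardD1 y) !inE eq_sym x_neq_y.
case/tupleP: p => z p; rewrite tuple0 /= andbT => -[xz _ zy].
by rewrite -zy xz in nadj_xy.
Qed.

Lemma dist_self x : dist x x = 0%N.
Proof.
by apply/eqP; rewrite -leqn0 dist_le //; apply/has_pathP; exists [tuple].
Qed.

Lemma adj_neq x y : adj x y -> x != y.
Proof. by apply: contraTneq => ->; rewrite adj_irr. Qed.

Lemma dist_adj x y : adj x y -> (dist x y <= 1)%N.
Proof.
move=> xy; apply: dist_le; apply/has_pathP; exists [tuple y].
by rewrite /= xy inE adj_neq.
Qed.

Lemma dist_common_neighbour x y z :
  x != y -> adj x z -> adj z y -> (dist x y <= 2)%N.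
Proof.
move=> x_neq_y xz zy; apply: dist_le; apply/has_pathP; exists [tuple z; y].
by rewrite /= xz zy !inE negb_or x_neq_y !adj_neq.
Qed.

Variable R : realType.

(* All distances between distinct vertices are at least 1, and at least 2
   between non-adjacent ones, so D(G) + I dominates J + (adjacency matrix of the
   complement of G). *)
Lemma distance_lambda1_ge (y : G -> R) :
    (0 < #|G|)%N -> (forall u, 0 <= y u) ->
  (\sum_u y u) ^+ 2 + \sum_u \sum_v (nonadj u v)%:R * (y u * y v)
    <= (lambda1 (distance_matrix R G) + 1) * \sum_u y u ^+ 2.
Proof.
move=> G_gt0 y_ge0; pose x : 'rV[R]_#|G| := \row_i y (enum_val i).
have D_sym : (distance_matrix R G)^T = distance_matrix R G.
  by apply/matrixP => i j; rewrite !mxE distC.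
have sumE (F : G -> R) : \sum_(i < #|G|) F (enum_val i) = \sum_u F u.
  by rewrite [RHS](reindex _ (onW_bij _ (enum_val_bij _))).
have := lambda1_ge x G_gt0 D_sym.
have -> : (x *m x^T) 0 0 = \sum_u y u ^+ 2.
  by rewrite mxE -sumE; apply: eq_bigr => i _; rewrite !mxE expr2.
have -> : (x *m distance_matrix R G *m x^T) 0 0 =
    \sum_v \sum_u y u * (dist u v)%:R * y v.
  rewrite mxE -sumE; apply: eq_bigr => j _; rewrite !mxE -mulr_suml; congr (_ * _).
  by rewrite -sumE; apply: eq_bigr => i _; rewrite !mxE.
move=> lam; rewrite mulrDl mul1r; apply: le_trans (lerD lam (lexx _)).
rewrite [X in _ <= X + _]exchange_big /= expr2 mulr_suml -!big_split /=.
apply: ler_sum => u _.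
rewrite mulr_sumr -big_split /= -lerBlDr.
rewrite [X in _ - X](_ : _ = \sum_v (u == v)%:R * (y u * y v)); last first.
  rewrite (bigD1 u) //= eqxx mul1r expr2 big1 ?addr0 // => v.
  by rewrite eq_sym => /negPf->; rewrite mul0r.
rewrite -sumrB; apply: ler_sum => v _.
have yy_ge0 : 0 <= y u * y v by rewrite mulr_ge0.
suff le_d : 1 + (nonadj u v)%:R - (u == v)%:R <= (dist u v)%:R :> R.
  rewrite mulrAC [leRHS]mulrC; apply: le_trans (ler_wpM2r yy_ge0 le_d).
  by rewrite mulrBl mulrDl mul1r.
have [<-|u_neq_v] := eqVneq u v; first by rewrite /nonadj eqxx addr0 subrr ler0n.
rewrite subr0; case nadj_uv: (nonadj u v); last by rewrite addr0 ler1n dist_gt0.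
by rewrite (_ : 1 + _ = 2%:R) ?ler_nat ?dist_gt1 ?nadj_uv.
Qed.

Lemma distance_lambda1_le (y : G -> R) (rho : R) :
    0 <= rho -> (forall u, 0 < y u) ->
    (forall v, \sum_u (dist u v)%:R * y u <= rho * y v) ->
  lambda1 (distance_matrix R G) <= rho.
Proof.
move=> rho_ge0 y_gt0 yD.
apply: (@lambda1_le _ _ _ (fun i => y (enum_val i))) => // [i j|j].
  by rewrite mxE ler0n.
apply: le_trans (yD (enum_val j)).
rewrite [leRHS](reindex _ (onW_bij _ (enum_val_bij _))) /=.
by apply: ler_sum => i _; rewrite mxE mulrC.
Qed.

End Distance.

(** * The quotient cubic, its root and the numerical estimates *)

Section Weights.
Variable R : realType.
Implicit Types mu n k : R.

(* The characteristic polynomial of the quotient of D + I, for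
   K_(k-1) v (K_(n-2k+1) U k K_1), evaluated at mu. *)
Definition quotient_poly mu n k :=
  (mu ^+ 2 + mu) * (mu - n) - k * (mu ^+ 2 + 2 * mu * n + 2 * mu + n + 1)
  + k ^+ 2 * (5 * mu + n + 3) - 2 * k ^+ 3.

(* If mu is a root of quotient_poly, these are the entries of a Perron vector on
   the independent vertices, the clique and the join part respectively, and
   total_weight is mu times the last one. *)
Definition leaf_weight mu n k := mu + (n - 2 * k + 1).
Definition clique_weight mu := mu + 1.
Definition total_weight mu n k := mu * (mu + 1) - k * leaf_weight mu n k.
Definition join_weight mu n k := total_weight mu n k / mu.

Definition weight_sum mu n k :=
  (k - 1) * join_weight mu n k + (n - 2 * k + 1) * clique_weight mu
  + k * leaf_weight mu n k.

(** Write a, b, c for the join, clique and leaf weights, T for [total_weight] and N = n - 2k + 1. By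
    construction mu a = T, mu b = T + k c and mu c = T + N b + (k - 1) c. These are the quotient
    equations once T is the actual sum of the entries, and the cubic measures that last defect. *)
Lemma weight_sumE mu n k : mu != 0 ->
  mu * (weight_sum mu n k - total_weight mu n k) = - quotient_poly mu n k.
Proof.
move=> mu_neq0; rewrite /weight_sum /join_weight /total_weight /leaf_weight.
by rewrite /clique_weight /quotient_poly; field.
Qed.

(** Let M be the all-ones matrix plus the non-adjacency matrix. The equations above say that M y -
    mu y is the constant vector F - T; pairing it with y, whose entries sum to F, gives the
    right-hand side. *)
Lemma weight_form mu n k : mu != 0 ->
  let a := join_weight mu n k in
  let b := clique_weight mu in
  let c := leaf_weight mu n k in
  let N := n - 2 * k + 1 in
  let F := weight_sum mu n k in
  F ^+ 2 + (k * (k - 1) * c ^+ 2 + 2 * k * N * (c * b))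
    - mu * ((k - 1) * a ^+ 2 + N * b ^+ 2 + k * c ^+ 2)
  = F * (F - total_weight mu n k).
Proof.
move=> mu_neq0 /=; rewrite /weight_sum /join_weight /total_weight /leaf_weight.
by rewrite /clique_weight; field.
Qed.

Lemma total_weight_gt0 mu n k : 1 <= k -> 2 * k <= n -> n <= mu ->
  0 < total_weight mu n k.
Proof. by move=> k_ge1 kn n_mu; rewrite /total_weight /leaf_weight; nra. Qed.

Lemma leaf_weight_gt0 mu n k : 1 <= k -> 2 * k <= n -> n <= mu ->
  0 < leaf_weight mu n k.
Proof. by move=> k_ge1 kn n_mu; rewrite /leaf_weight; lra. Qed.

Lemma leaf_clique_weight mu n k : 1 <= k -> 2 * k <= n -> n <= mu ->
  leaf_weight mu n k < 2 * clique_weight mu.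
Proof. by move=> k_ge1 kn n_mu; rewrite /leaf_weight /clique_weight; lra. Qed.

Lemma weight_sum_gt0 mu n k : 1 <= k -> 2 * k <= n -> n <= mu ->
  0 < weight_sum mu n k.
Proof.
move=> k_ge1 kn n_mu; rewrite /weight_sum /join_weight.
have := leaf_weight_gt0 k_ge1 kn n_mu; have := total_weight_gt0 k_ge1 kn n_mu.
set T := total_weight _ _ _; set c := leaf_weight _ _ _ => T_gt0 c_gt0.
have mu_gt0 : 0 < mu by lra.
have a_ge0 : 0 <= (k - 1) * (T / mu).
  by rewrite mulr_ge0 ?subr_ge0 // divr_ge0 ?ltW.
have b_ge0 : 0 <= (n - 2 * k + 1) * clique_weight mu.
  by rewrite mulr_ge0 /clique_weight //; lra.
have : 0 < k * c by rewrite mulr_gt0 //; lra.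
by lra.
Qed.

(* Closes goals [0 <= e] where e is built from nonnegative atoms without
   subtraction. *)
Ltac positive :=
  repeat (first [ assumption | exact: ler0n | exact: ler01
    | apply: addr_ge0 | apply: mulr_ge0 | apply: exprn_ge0
    | rewrite invr_ge0 ]).

(** Intermediate value theorem on [[L, min U1 U2]]. The lower bound serves [quotient_poly_lt0]; the
    two upper bounds are the positivity conditions at the end points q = 2 d and q = 5 n / 9 in
    [small_cut_form]. *)
Lemma quotient_poly_root d n : 2 <= d -> 9 * d <= n ->
  exists mu, [/\ quotient_poly mu n (d + 1) = 0,
    n + 3 / 2 * (d + 1) <= mu,
    mu * (n + 6 * d) < n ^+ 2 + 12 * d * n - 4 * (d * (d + 2)) &
    18 * mu < 23 * n + 15 * (d - 1)].
Proof.
move=> d_ge2 n_ge.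
pose k := d + 1.
pose p : {poly R} := ('X^2 + 'X) * ('X - n%:P)
  - k%:P * ('X^2 + 2%:P * 'X * n%:P + 2%:P * 'X + n%:P + 1)
  + (k ^+ 2)%:P * (5%:P * 'X + n%:P + 3%:P) - (2 * k ^+ 3)%:P.
have pE mu : p.[mu] = quotient_poly mu n k.
  by rewrite /p /quotient_poly !hornerE.
(* In the variables j = d - 2 and v = n - 9 d the sign conditions at the ends of
   the interval become polynomials with coefficients of one sign. Large
   coefficients are written in base 1000 because numerals are unary. *)
have [j dE] : exists j, d = 2 + j by exists (d - 2); lra.
have [v nE] : exists v, n = 9 * d + v by exists (n - 9 * d); lra.
have j_ge0 : 0 <= j by lra.
have v_ge0 : 0 <= v by lra.
pose L := n + 3 / 2 * k.
pose U1 := (n ^+ 2 + 12 * d * n - 4 * (d * (d + 2))) / (n + 6 * d).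
pose U2 := (23 * n + 15 * (d - 1)) / 18.
have den_gt0 : 0 < n + 6 * d by lra.
have pL : p.[L] <= 0.
  rewrite pE -oppr_ge0 /quotient_poly /L /k nE dE.
  rewrite [leRHS](_ : _ = ((4 * 1000 + 911) + (1 * 1000 + 8) * v + 36 * v ^+
    2 + (7 * 1000 + 757) * j + 876 * j * v + 12 * j * v ^+ 2 + (3 * 1000 +
    825) * j ^+ 2 + 180 * j ^+ 2 * v + 595 * j ^+ 3) / 8); last by field.
  by rewrite divr_ge0 //; positive.
have pU1 : 0 < p.[U1].
  rewrite -(pmulr_lgt0 _ (exprn_gt0 3 den_gt0)) pE.
  rewrite [ltRHS](_ : _ = ((10 * 1000 + 414) * 1000 + 624) + (((3 * 1000 +
    349) * 1000) * v + (381 * 1000 + 404) * v ^+ 2 + (18 * 1000 + 970) * v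
    ^+ 3 + 403 * v ^+ 4 + 3 * v ^+ 5 + ((46 * 1000 + 402) * 1000 + 896) * j
    + ((11 * 1000 + 692) * 1000 + 700) * j * v + ((1 * 1000 + 36) * 1000 +
    864) * j * v ^+ 2 + (39 * 1000 + 175) * j * v ^+ 3 + 606 * j * v ^+ 4 +
    3 * j * v ^+ 5 + ((77 * 1000 + 643) * 1000 + 408) * j ^+ 2 + ((15 * 1000
    + 111) * 1000 + 430) * j ^+ 2 * v + (988 * 1000 + 39) * j ^+ 2 * v ^+ 2
    + (25 * 1000 + 49) * j ^+ 2 * v ^+ 3 + 203 * j ^+ 2 * v ^+ 4 + ((65 *
    1000 + 322) * 1000 + 48) * j ^+ 3 + ((9 * 1000 + 314) * 1000 + 705) * j
    ^+ 3 * v + (401 * 1000 + 99) * j ^+ 3 * v ^+ 2 + (5 * 1000 + 102) * j ^+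
    3 * v ^+ 3 + ((29 * 1000 + 757) * 1000 + 870) * j ^+ 4 + ((2 * 1000 +
    780) * 1000 + 920) * j ^+ 4 * v + (59 * 1000 + 310) * j ^+ 4 * v ^+ 2 +
    ((7 * 1000 + 39) * 1000 + 875) * j ^+ 5 + (324 * 1000 + 575) * j ^+ 5 *
    v + (680 * 1000 + 375) * j ^+ 6)).
    by apply: ltr_pwDl; [lra | positive].
  rewrite /quotient_poly /U1 /k nE dE; field.
  by move: den_gt0; rewrite nE dE lt0r => /andP[].
have pU2 : 0 < p.[U2].
  rewrite pE /quotient_poly /U2 /k nE dE.
  rewrite [ltRHS](_ : _ = (((1 * 1000 + 61) * 1000 + 73) + ((695 * 1000 +
    547) * v + (83 * 1000 + 7) * v ^+ 2 + (2 * 1000 + 645) * v ^+ 3 + ((5 *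
    1000 + 370) * 1000 + 138) * j + ((1 * 1000 + 204) * 1000 + 416) * j * v
    + (58 * 1000 + 374) * j * v ^+ 2 + ((4 * 1000 + 766) * 1000 + 688) * j
    ^+ 2 + (440 * 1000 + 424) * j ^+ 2 * v + ((1 * 1000 + 175) * 1000 + 688)
    * j ^+ 3)) / (5 * 1000 + 832)); last by field.
  by rewrite divr_gt0 //; [apply: ltr_pwDl; [lra | positive] | lra].
pose U := Num.min U1 U2.
have pU : 0 < p.[U] by rewrite /U minEle; case: ifP.
have L_U1 : L <= U1.
  by rewrite /U1 ler_pdivlMr // /L /k; nra.
have L_U2 : L <= U2.
  by rewrite /U2 ler_pdivlMr // /L /k; lra.
have L_U : L <= U by rewrite /U le_min L_U1.
have [|mu /andP[L_mu mu_U] /rootP p_mu] := @poly_ivt _ p L U L_U.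
  by rewrite pL ltW.
have {}mu_U : mu < U.
  by rewrite lt_neqAle mu_U andbT; apply: contraTneq pU => <-; rewrite p_mu ltxx.
have [mu_U1 mu_U2] : mu < U1 /\ mu < U2.
  by move: mu_U; rewrite /U lt_min => /andP.
exists mu; split=> //.
- by rewrite -pE.
- by rewrite -ltr_pdivlMr.
- by rewrite mulrC -ltr_pdivlMr.
Qed.

(** Dividing out the root k = d + 1 leaves [slope], quadratic in k. Its value at k is at most its
    value at n / 2, which is negative. *)
Lemma quotient_poly_lt0 mu d n k :
    2 <= d -> 9 * d <= n -> quotient_poly mu n (d + 1) = 0 ->
    n + 3 / 2 * (d + 1) <= mu -> d + 1 < k -> 2 * k <= n ->
  quotient_poly mu n k < 0.
Proof.
move=> d_ge2 n_ge root_mu mu_ge k_gt k_le; pose l := d + 1.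
pose slope x := (l + x) * (5 * mu + n + 3) - 2 * (l ^+ 2 + l * x + x ^+ 2)
  - (mu ^+ 2 + 2 * mu * n + 2 * mu + n + 1).
have -> : quotient_poly mu n k = (k - l) * slope k.
  by rewrite -[LHS]subr0 -root_mu /quotient_poly /slope /l; ring.
rewrite pmulr_rlt0; last by rewrite /l; lra.
have slope_half : slope (n / 2) < 0.
  have [j dE] : exists j, d = 2 + j by exists (d - 2); lra.
  have [v nE] : exists v, n = 9 * d + v by exists (n - 9 * d); lra.
  have [w muE] : exists w, mu = n + 3 / 2 * (d + 1) + w.
    by exists (mu - (n + 3 / 2 * (d + 1))); lra.
  have j_ge0 : 0 <= j by lra.
  have v_ge0 : 0 <= v by lra.
  have w_ge0 : 0 <= w by lra.
  rewrite -oppr_gt0 [ltRHS](_ : _ = 49 / 4 + (45 / 4 * v + 1 / 2 * v ^+ 2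
    + 129 / 4 * j + 25 / 4 * j * v + 25 / 2 * j ^+ 2)
    + w * (w + 23 + 3 / 2 * v + (10 + 1 / 2 + 1) * j)); last first.
    by rewrite /slope /l muE nE dE; field.
  apply: ltr_pwDl; last by positive.
  apply: ltr_pwDl; first lra.
  by positive.
apply: le_lt_trans slope_half; rewrite -subr_ge0.
have -> : slope (n / 2) - slope k =
    (n / 2 - k) * (5 * mu + n + 3 - 2 * (l + n / 2 + k)).
  by rewrite /slope; field.
by rewrite mulr_ge0 // /l; lra.
Qed.

(* The right-hand side minus the left-hand side is bounded below by a concave
   quadratic in q, positive at q = 2 d and q = 5 n / 9; for larger q the second
   bound on P takes over. *)
Lemma small_cut_form mu d n s q n1 P : 2 <= d -> 9 * d <= n ->
    mu * (n + 6 * d) < n ^+ 2 + 12 * d * n - 4 * (d * (d + 2)) ->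
    18 * mu < 23 * n + 15 * (d - 1) ->
    1 <= s -> s <= d - 1 -> n = s + n1 + q -> (s + 1) * (d - s + 1) <= q ->
    q * (s * (d - s + 1)) <= P -> q * (q - n1) <= P ->
  mu * (n + 3 * q) < (n + q) ^+ 2 + (4 * q * n1 + 4 * P).
Proof.
move=> d_ge2 n_ge mu_U1 mu_U2 s_ge1 s_le nE q_ge P_ge1 P_ge2.
have q_ge2d : 2 * d <= q by nra.
have n1E : n1 = n - s - q by lra.
have [q_le|q_gt] := leP (9 * q) (5 * n); last first.
  (* The second bound on [P] gives 4 q n1 + 4 P >= 4 q^2. The constant 37/27 comes from [mu_U2] and
     d <= n / 9. *)
  apply: lt_le_trans (_ : (n + q) ^+ 2 + 4 * q ^+ 2 <= _); last by nra.
  apply: lt_le_trans (_ : 37 / 27 * n * (n + 3 * q) <= _).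
    by rewrite ltr_pM2r; lra.
  by rewrite -subr_ge0 [leRHS](_ : _ = (q - 5 / 9 * n) * (5 * q + 2 / 3 * n));
    [rewrite mulr_ge0 //; lra | field].
(* Inserting n1 = n - s - q and the first bound on [P] turns the last bracket into at least 4 q (n -
   q + s (d - s)), and s (d - s) >= d - 1 for s between 1 and d - 1. *)
pose g x := (n + x) ^+ 2 + 4 * x * (n - x) + 4 * x * (d - 1) - mu * (n + 3 * x).
have g_le : g q <= (n + q) ^+ 2 + (4 * q * n1 + 4 * P) - mu * (n + 3 * q).
  have sd : d - 1 <= s * (d - s) by nra.
  have : q * (d - 1) <= q * (s * (d - s)) by rewrite ler_pM2l //; lra.
  by rewrite /g n1E; nra.
rewrite -subr_gt0; apply: lt_le_trans g_le.
have gA : 0 < g (2 * d).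
  by rewrite /g [ltRHS](_ : _ = n ^+ 2 + 12 * d * n - 4 * (d * (d + 2))
    - mu * (n + 6 * d)); [rewrite subr_gt0 | ring].
have gE : 0 < g (5 / 9 * n).
  rewrite /g [ltRHS](_ : _ = 4 / 27 * n * (23 * n + 15 * (d - 1) - 18 * mu));
    last by field.
  by rewrite mulr_gt0 ?subr_gt0 //; lra.
have E_A : 0 < 5 / 9 * n - 2 * d by lra.
(* Chord interpolation between 2 d and 5 n / 9; the factor 3 is minus the leading coefficient of
   [g]. *)
rewrite -(pmulr_rgt0 _ E_A).
rewrite [ltRHS](_ : _ = (5 / 9 * n - q) * g (2 * d) + (q - 2 * d) * g (5 / 9 * n)
  + 3 * ((5 / 9 * n - 2 * d) * ((q - 2 * d) * (5 / 9 * n - q)))); last first.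
  by rewrite /g; field.
have [qA|qA] := leP q (2 * d).
  by have -> : q = 2 * d by [lra]; rewrite subrr !mul0r !mulr0 !addr0 mulr_gt0.
apply: ltr_wpDr.
  by rewrite mulr_ge0 // mulr_ge0 ?mulr_ge0 //; lra.
by rewrite ltr_wpDl ?mulr_ge0 ?mulr_gt0 //; lra.
Qed.

End Weights.

(** * Upper bound for the extremal graph *)

Section ExtremalGraph.
Variables (R : realType) (n d : nat).
Let G := extremal_graph n d.

Lemma extremal_dist (u v : G) : (0 < d)%N ->
  (dist u v + (u == v) <= 1 + nonadj u v)%N.
Proof.
move=> d_gt0; have [<-|u_neq_v] := eqVneq u v; first by rewrite dist_self.
rewrite addn0 /nonadj u_neq_v; case uv: (adj u v).
  exact: dist_adj.
(* Two distinct non-adjacent vertices both lie outside the join part, so any vertex of that part is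
   a common neighbour. *)
pose z : G := inl (Ordinal d_gt0).
apply: (@dist_common_neighbour _ _ _ z) => //.
  case: u uv u_neq_v => // x; case: v => // y /negbT.
  by rewrite negbK => /eqP->; rewrite eqxx.
case: v uv u_neq_v => // y; case: u => // x /negbT.
by rewrite negbK => /eqP->; rewrite eqxx.
Qed.

Lemma extremal_lambda1_le (mu : R) (k := d%:R + 1) :
    (0 < d)%N -> (2 * d.+1 <= n)%N -> n%:R <= mu ->
    quotient_poly mu n%:R k = 0 ->
  lambda1 (distance_matrix R G) <= mu - 1.
Proof.
move=> d_gt0 n_ge n_mu root_mu.
have k_ge1 : 1 <= k by rewrite /k lerDr ler0n.
have k_n : 2 * k <= n%:R by rewrite /k natr1 -natrM ler_nat.
have d_n : (2 * d + 1 <= n)%N by lia.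
have mu_ge2 : 2 <= mu by lra.
have mu_neq0 : mu != 0 by rewrite gt_eqF //; lra.
have NE : (n - 2 * d - 1)%:R = n%:R - 2 * k + 1 :> R.
  by rewrite -subnDA natrB // natrD natrM /k; ring.
pose a := join_weight mu n%:R k; pose b := clique_weight mu.
pose c := leaf_weight mu n%:R k.
pose y (u : G) : R :=
  match u with inl _ => a | inr (inl _) => b | inr (inr _) => c end.
have sumE (F : G -> R) : \sum_u F u = \sum_(i < d) F (inl i)
    + (\sum_(i < n - 2 * d - 1) F (inr (inl i)) + \sum_(i < d.+1) F (inr (inr i))).
  by rewrite big_sumType /=; congr (_ + _); rewrite big_sumType.
have sum_cst (m : nat) (x : R) : \sum_(i < m) x = m%:R * x.
  by rewrite sumr_const card_ord mulr_natl.
have T_gt0 := total_weight_gt0 k_ge1 k_n n_mu.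
have sum_y : \sum_u y u = total_weight mu n%:R k.
  have := weight_sumE n%:R k mu_neq0; rewrite root_mu oppr0 => /eqP.
  rewrite mulf_eq0 (negPf mu_neq0) subr_eq0 /= => /eqP <-.
  rewrite sumE /= !sum_cst NE -[d.+1%:R]natr1 -/k addrA /weight_sum.
  by rewrite [k - 1](_ : _ = d%:R) //; rewrite /k addrK.
have y_gt0 u : 0 < y u.
  case: u => [_|[_|_]] /=; first by rewrite divr_gt0 //; lra.
    by rewrite /b /clique_weight; lra.
  exact: leaf_weight_gt0.
apply: (@distance_lambda1_le _ _ y) => // [|v]; first lra.
(* Entrywise, D is at most J - I plus the non-adjacency matrix; the term -I accounts for the shift
   from [mu] to [mu - 1]. *)
apply: le_trans (_ : \sum_u (1 - (u == v)%:R + (nonadj u v)%:R) * y u <= _).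
  apply: ler_sum => u _; apply: ler_wpM2r; first exact: ltW.
  by have := extremal_dist u v d_gt0; rewrite -(ler_nat R) !natrD; lra.
rewrite (eq_bigr (fun u => y u - (u == v)%:R * y u + (nonadj u v)%:R * y u)); last first.
  by move=> u _; ring.
rewrite big_split sumrB /= sum_y.
have -> : \sum_u (u == v)%:R * y u = y v.
  rewrite (bigD1 v) //= eqxx mul1r big1 ?addr0 // => u /negPf->.
  by rewrite mul0r.
rewrite mulrBl mul1r addrAC lerB // sumE.
have nadj_ll (m : nat) (x : 'I_m) (f : 'I_m -> bool) :
    (forall i, f i = (i != x)) -> \sum_i (f i)%:R * c = (m%:R - 1) * c.
  move=> fE; rewrite -mulr_suml (bigD1 x) //= fE eqxx add0r; congr (_ * _).
  rewrite (eq_bigr (fun=> 1)) => [|i /negPf i_neq]; last by rewrite fE i_neq.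
  rewrite sumr_const cardC1 card_ord -subn1 natrB //.
  exact: leq_ltn_trans (ltn_ord x).
(* The three cases are the quotient equations for the join part, the clique and the independent
   vertices. *)
case: v => [x|[x|x]] /=; rewrite ?sum_cst ?mul0r ?mulr0 ?add0r ?addr0 ?mul1r.
- rewrite big1 => [|i _]; first by rewrite addr0 /a /join_weight mulrC divfK.
  by rewrite /nonadj /= /complete_rel andbN mul0r.
- rewrite big1 => [|i _]; last by rewrite /nonadj /= /complete_rel andbN mul0r.
  by rewrite add0r -[d.+1%:R]natr1 -/k /b /clique_weight /total_weight -/c subrK.
- rewrite (nadj_ll _ x) => [|i]; last by rewrite /nonadj /= andbT.
  rewrite NE -[d.+1%:R]natr1 -/k /b /clique_weight /total_weight -/c.
  by rewrite /c /leaf_weight le_eqVlt; apply/orP; left; apply/eqP; ring.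
Qed.

End ExtremalGraph.

(** * From failing toughness to a labelled cut *)

(* A labelling of the vertices outside S that is constant on the components of
   G - S. *)
Definition respects_cut (G : sgraph) (T : eqType) (S : {set G}) (lab : G -> T) :=
  forall x y, x \notin S -> y \notin S -> adj x y -> lab x = lab y.

(** The label of a vertex is the root of its component in G - S; the option type makes the labelling
    total, with [None] on S. *)
Lemma component_labelling (G : sgraph) (S : {set G}) :
  exists (T : finType) (lab : G -> T),
    respects_cut S lab /\
    #|lab @: (~: S)| = num_components (del_vertices S).
Proof.
pose H := del_vertices S; pose r := fingraph.root (@adj H).
have connC : connect_sym (@adj H).
  apply: sym_connect_sym; exact: adj_sym.
pose lab (x : G) : option H := omap r (insub x).
exists (option H), lab; split=> [x y xS yS xy|].
  rewrite /lab (insubT (fun x => x \notin S) xS) (insubT (fun x => x \notin S) yS) /=.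
  by congr Some; apply/eqP; rewrite /r root_connect // connect1.
have -> : lab @: (~: S) = Some @: [set z : H | fingraph.roots (@adj H) z].
  apply/setP => t; apply/imsetP/imsetP => [[x]|[z]].
    rewrite inE => xS ->; exists (r (Sub x xS)); first by rewrite inE roots_root.
    by rewrite /lab (insubT (fun x => x \notin S) xS).
  rewrite inE => /eqP z_root ->; exists (val z); first by rewrite inE (valP z).
  by rewrite /lab valK /= /r z_root.
rewrite card_imset; last by move=> z z' [].
by rewrite /num_components cardsE; apply: eq_card => z; rewrite !inE ?andbT.
Qed.

(** At a minimiser the ratio is below 1, so |S| < c - 1; integrality yields the offset 2. *)
Lemma not_tough_cut (G : sgraph) : ~ tough 1 G ->
  exists S : {set G}, (#|S| + 2 <= num_components (del_vertices S))%N.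
Proof.
rewrite /tough /toughness; case: pickP => [S0 S0_sep|//] /negP.
have [S S_sep _] := @Order.TotalTheory.arg_minP _ _ _ S0 (mem (separating G))
  (@tough_ratio G) S0_sep.
have {S_sep} c_gt1 : (1 < num_components (del_vertices S))%N.
  by have : S \in separating G := S_sep; rewrite inE.
rewrite -ltNge /tough_ratio => ratio.
exists S; move: ratio; rewrite ltr_pdivrMr ?mul1r; last first.
  by rewrite subr_gt0 ltr1n.
by rewrite ltrBrDr natr1 ltr_nat addn2.
Qed.

Lemma sum_mem (R : realType) (T : finType) (A : {set T}) :
  \sum_u (u \in A)%:R = #|A|%:R :> R.
Proof.
by rewrite -sum1_card natr_sum [RHS]big_mkcond; apply: eq_bigr => u _; case: ifP.
Qed.

Lemma double_sum_mem (R : realType) (T : finType) (A B : {set T}) (x : R) :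
  \sum_u \sum_v (u \in A)%:R * (v \in B)%:R * x = #|A|%:R * #|B|%:R * x.
Proof.
rewrite -!sum_mem !mulr_suml; apply: eq_bigr => u _.
by rewrite mulr_sumr mulr_suml.
Qed.

(** * Blocks of a cut, and cuts smaller than the minimum degree *)

Section Cut.
Variables (R : realType) (G : sgraph) (T : finType) (S : {set G}) (lab : G -> T).
Hypothesis lab_cut : respects_cut S lab.
Implicit Types (x y u v : G) (l : T).

Definition block l := [set x in ~: S | lab x == l].

Lemma nonadj_lab x y : x \notin S -> y \notin S -> lab x != lab y -> nonadj x y.
Proof.
move=> xS yS; rewrite /nonadj => lab_neq; apply/andP; split.
  by apply: contraNneq lab_neq => ->.
by apply: contra lab_neq => xy; apply/eqP/lab_cut.
Qed.

Lemma max_block : lab @: (~: S) != set0 ->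
  exists2 l, (0 < #|block l|)%N & forall l', (#|block l'| <= #|block l|)%N.
Proof.
case/set0Pn => l0 /imsetP[x xS l0E].
have [l _ l_max] := @arg_maxnP _ l0 xpredT (fun l => #|block l|) isT.
exists l => [|l']; last exact: l_max.
apply: leq_trans (l_max l0 isT); apply/card_gt0P; exists x.
by rewrite l0E inE xS eqxx.
Qed.

(** All neighbours of x lie in S or in the block of x, and that block also contains x itself, whence
    the extra 1. *)
Lemma block_card (d : nat) x : (forall u, d <= degree u)%N -> x \notin S ->
  (d + 1 <= #|S| + #|block (lab x)|)%N.
Proof.
move=> deg_ge xS.
suff: [set y | adj x y] \subset S :|: (block (lab x) :\ x).
  move/subset_leq_card/(leq_trans (deg_ge x)); rewrite cardsU.
  rewrite [in X in _ -> X](cardsD1 x (block _)) !inE xS eqxx addnCA.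
  by lia.
apply/subsetP => y; rewrite !inE => xy; case: (boolP (y \in S)) => //= yS.
rewrite eq_sym adj_neq //=; apply/eqP; apply: lab_cut => //.
by rewrite adj_sym.
Qed.

Lemma card_blocks (A : {set T}) (m : nat) :
    (forall l, l \in A -> m <= #|block l|)%N ->
  (#|A| * m <= #|[set x in ~: S | lab x \in A]|)%N.
Proof.
move=> m_le; rewrite -[leqRHS]sum1_card (partition_big lab (mem A)) => [|x]; last first.
  by rewrite !inE => /andP[].
rewrite -sum_nat_const; apply: leq_sum => l lA; apply: leq_trans (m_le l lA) _.
rewrite -[leqLHS]sum1_card; apply/eq_leq/eq_bigl => x; rewrite !inE.
by case: eqP => [->|]; rewrite ?lA ?andbT ?andbF.
Qed.

Lemma small_cut_lambda1 (d n : nat) (mu : R) : #|G| = n ->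
    (2 <= d)%N -> (9 * d <= n)%N -> (forall u, d <= degree u)%N ->
    (0 < #|S| < d)%N -> (#|S| + 2 <= #|lab @: (~: S)|)%N ->
    mu * (n%:R + 6 * d%:R)
      < n%:R ^+ 2 + 12 * d%:R * n%:R - 4 * (d%:R * (d%:R + 2)) ->
    18 * mu < 23 * n%:R + 15 * (d%:R - 1) ->
  mu < lambda1 (distance_matrix R G) + 1.
Proof.
move=> nE d_ge2 n_ge deg_ge /andP[s_gt0 s_lt] L_ge mu_U1 mu_U2.
have [|l1 _ l1_max] := max_block.
  by rewrite -card_gt0; lia.
set s := #|S| in s_gt0 s_lt L_ge; set L := lab @: (~: S) in L_ge.
pose Q := [set x in ~: S | lab x != l1]; pose B1 := block l1.
pose q := #|Q|; pose n1 := #|B1|.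
have nqs : n = (s + n1 + q)%N.
  rewrite -nE -(cardsC S) -addnA; congr (_ + _)%N.
  rewrite -(cardsID [set x | lab x == l1]); congr (_ + _)%N; apply: eq_card => x.
    by rewrite !inE.
  by rewrite !inE andbC.
have block_ge l : l \in L -> (d - s + 1 <= #|block l|)%N.
  case/imsetP => x; rewrite inE => xS ->; have := block_card deg_ge xS.
  by rewrite -/s; lia.
have q_ge : ((s + 1) * (d - s + 1) <= q)%N.
  have L1_ge : (s + 1 <= #|L :\ l1|)%N.
    by move: L_ge; rewrite (cardsD1 l1); case: (_ \in L) => /=; lia.
  apply: leq_trans (leq_mul L1_ge (leqnn _)) _.
  apply: leq_trans (card_blocks _) _ => [l|]; first by rewrite inE => /andP[_ /block_ge].
  by apply/subset_leq_card/subsetP => x; rewrite !inE => /and3P[-> ->].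
(* Ordered pairs in [Q] with different labels. For each u, at least s labels remain besides [l1] and
   that of u, which gives [P_ge1]; the block of u has at most [n1] vertices, which gives [P_ge2]. *)
pose P := (\sum_(u in Q) #|[set v in Q | lab v != lab u]|)%N.
have P_ge1 : (q * (s * (d - s + 1)) <= P)%N.
  rewrite -sum_nat_const; apply: leq_sum => u _.
  have L2_ge : (s <= #|(L :\ l1) :\ lab u|)%N.
    move: L_ge; rewrite (cardsD1 l1) (cardsD1 (lab u) (_ :\ _)).
    by case: (_ \in _); case: (_ \in _) => /=; lia.
  apply: leq_trans (leq_mul L2_ge (leqnn _)) _.
  apply: leq_trans (card_blocks _) _ => [l|].
    by rewrite !inE => /and3P[_ _ /block_ge].
  apply/subset_leq_card/subsetP => x; rewrite !inE.
  by case/and4P => -> -> -> _.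
have P_ge2 : q%:R * (q%:R - n1%:R) <= P%:R :> R.
  rewrite natr_sum mulr_natl -sumr_const; apply: ler_sum => u _.
  rewrite lerBlDr -natrD ler_nat addnC.
  apply: leq_trans (leq_add (l1_max (lab u)) (leqnn _)).
  rewrite -cardsUI; apply: leq_trans (leq_addr _ _).
  apply/subset_leq_card/subsetP => x; rewrite !inE => /andP[-> ->] /=.
  by rewrite orbN.
pose y u : R := if u \in Q then 2 else 1.
have y_ge0 u : 0 <= y u by rewrite /y; case: ifP.
have G_gt0 : (0 < #|G|)%N by lia.
have := distance_lambda1_ge G_gt0 y_ge0.
have sum1 : \sum_(u : G) 1 = n%:R :> R by rewrite sumr_const nE.
have -> : \sum_u y u = n%:R + q%:R.
  rewrite -sum1 -sum_mem -big_split; apply: eq_bigr => u _.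
  by rewrite /y; case: (u \in Q) => /=; ring.
have -> : \sum_u y u ^+ 2 = n%:R + 3 * q%:R.
  rewrite -sum1 -sum_mem mulr_sumr -big_split; apply: eq_bigr => u _.
  by rewrite /y; case: (u \in Q) => /=; ring.
have form_ge : 4 * q%:R * n1%:R + 4 * P%:R
    <= \sum_u \sum_v (nonadj u v)%:R * (y u * y v).
  pose e u v : R := (u \in B1)%:R * (v \in Q)%:R * 2
    + (u \in Q)%:R * (v \in B1)%:R * 2
    + (u \in Q)%:R * ((v \in Q) && (lab v != lab u))%:R * 4.
  have -> : 4 * q%:R * n1%:R + 4 * P%:R = \sum_u \sum_v e u v.
    under eq_bigr do rewrite !big_split /=.
    rewrite !big_split /= !double_sum_mem; congr (_ + _); first by rewrite -/q -/n1; ring.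
    rewrite natr_sum mulr_sumr big_mkcond; apply: eq_bigr => u _.
    rewrite -mulr_suml -mulr_sumr; case: (u \in Q); last by rewrite !mul0r.
    rewrite mul1r mulrC -sum_mem; congr (_ * _).
    by apply: eq_bigr => v _; rewrite inE.
  apply: ler_sum => u _; apply: ler_sum => v _; rewrite /e /y !inE.
  have := @nonadj_lab u v.
  case: (u \in S) => /= [_|].
    by rewrite !mul0r !add0r mulr_ge0 ?ler0n // mulr_ge0 //; case: ifP.
  case: (v \in S) => /= [_|/(_ isT isT)].
    by rewrite !mulr0 !mul0r !add0r mulr_ge0 ?ler0n // mulr_ge0 //; case: ifP.
  case: (eqVneq (lab u) l1) => [ul|ul]; case: (eqVneq (lab v) l1) => [vl|vl] /=.
  + by rewrite !mulr0 !mul0r !add0r mulr1 mulr1 ler0n.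
  + by rewrite ul eq_sym vl => -> //=; lra.
  + by rewrite vl ul => -> //=; lra.
  + rewrite eq_sym; case: (lab v != lab u) => [->//|_] /=; first lra.
    by rewrite !mulr0 !mul0r !add0r mulr_ge0 ?ler0n // mulr_ge0.
move=> lam; have q_ge0 : 0 <= q%:R :> R by rewrite ler0n.
have nq_gt0 : 0 < n%:R + 3 * q%:R :> R.
  by rewrite ltr_wpDr ?mulr_ge0 // ltr0n -nE.
rewrite -(ltr_pM2r nq_gt0); apply: lt_le_trans lam.
apply: lt_le_trans (lerD (lexx _) form_ge).
have dsE : (d - s + 1)%:R = d%:R - s%:R + 1 :> R.
  by rewrite natrD natrB // ltnW.
apply: (@small_cut_form _ mu d%:R n%:R s%:R) => //.
- by rewrite ler_nat.
- by rewrite -natrM ler_nat.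
- by rewrite ler1n.
- by rewrite lerBrDr natr1 ler_nat.
- by rewrite nqs !natrD.
- by rewrite -dsE natr1 -natrM ler_nat -addn1.
- by rewrite -dsE -!natrM ler_nat.
Qed.

(** The strict inequality pays for the label [l1], which the representatives must avoid. *)
Lemma block_representatives l1 (k : nat) : (k < #|lab @: (~: S)|)%N ->
  exists C : {set G}, [/\ #|C| = k, {in C &, injective lab} &
    forall x, x \in C -> x \notin S /\ lab x != l1].
Proof.
set L := lab @: (~: S) => k_lt.
have [x0 _] : exists x : G, x \in G.
  have /card_gt0P[l /imsetP[x _ _]] : (0 < #|L|)%N by exact: leq_ltn_trans k_lt.
  by exists x.
have /fin_all_exists[rep repP] l : exists x, l \in L -> x \notin S /\ lab x = l.
  case: (boolP (l \in L)) => [/imsetP[x]|]; last by exists x0.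
  by rewrite inE => xS ->; exists x.
have k_le : (k <= size (enum (L :\ l1)))%N.
  by rewrite -cardE; move: k_lt; rewrite (cardsD1 l1); case: (_ \in L) => /=; lia.
pose A := [set l in take k (enum (L :\ l1))].
have AP l : l \in A -> l \in L /\ l != l1.
  by rewrite inE => /mem_take; rewrite mem_enum !inE => /andP[-> ->].
have lab_rep : {in A, cancel rep lab} by move=> l /AP[/repP[]].
exists (rep @: A); split.
- rewrite card_in_imset; last exact: can_in_inj lab_rep.
  rewrite cardsE (card_uniqP _) ?size_takel //.
  by rewrite take_uniq // enum_uniq.
- by move=> _ _ /imsetP[l lA ->] /imsetP[l' l'A ->]; rewrite !lab_rep // => ->.
- by move=> _ /imsetP[l lA ->]; have [lL l_neq] := AP l lA; have [? ->] := repP l lL.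
Qed.

(** * Comparison with the three-part model graph *)

Section Tripartite.
Variables (C : {set G}) (l1 : T) (a b c : R).
Hypothesis C_inj : {in C &, injective lab}.
Hypothesis CP : forall x, x \in C -> x \notin S /\ lab x != l1.
Hypotheses (l1_gt0 : (0 < #|block l1|)%N)
  (l1_max : forall l, (#|block l| <= #|block l1|)%N).
Hypotheses (a_gt0 : 0 < a) (b_gt0 : 0 < b) (c_gt0 : 0 < c) (c_lt : c < 2 * b).

Definition tri_weight u : R := if u \in S then a else if u \in C then c else b.

(** Non-adjacency in the model where S is joined to everything, C is independent and the remaining
    vertices form a clique. *)
Definition tri_nonadj u v :=
  [&& u \notin S, v \notin S, u != v & (u \in C) || (v \in C)].

Let B := ~: (S :|: C).
Let k : R := #|C|%:R.
Let N : R := #|B|%:R.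

Lemma sum_tri (f : R -> R) :
  \sum_u f (tri_weight u) = #|S|%:R * f a + N * f b + k * f c.
Proof.
rewrite /N /k -!sum_mem !mulr_suml -!big_split; apply: eq_bigr => u _ /=.
rewrite /tri_weight /B !inE; case uC: (u \in C) => /=.
  by have [/negPf-> _] := CP uC; rewrite /=; ring.
by case: (u \in S) => /=; ring.
Qed.

Lemma tri_weight_gt0 u : 0 < tri_weight u.
Proof. by rewrite /tri_weight; case: (u \in S); case: (u \in C). Qed.

Let base := k * (k - 1) * c ^+ 2 + 2 * k * N * (c * b).

Lemma tri_base : \sum_u \sum_v (tri_nonadj u v)%:R * (tri_weight u * tri_weight v)
  = base.
Proof.
rewrite (eq_bigr (fun u => \sum_v ((u \in C)%:R * (v \in C)%:R * c ^+ 2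
    + (u \in C)%:R * (v \in B)%:R * (c * b) + (u \in B)%:R * (v \in C)%:R * (c * b))
    - (u \in C)%:R * c ^+ 2)); last first.
  move=> u _.
  have -> : (u \in C)%:R * c ^+ 2 = \sum_v (u == v)%:R * ((u \in C)%:R * c ^+ 2).
    rewrite (bigD1 u) //= eqxx mul1r big1 ?addr0 // => v.
    by rewrite eq_sym => /negPf->; rewrite mul0r.
  rewrite -sumrB; apply: eq_bigr => v _; rewrite /tri_nonadj /tri_weight /B !inE.
  case uC: (u \in C); case vC: (v \in C) => /=; rewrite ?orbT ?orbF.
  - have [/negPf-> _] := CP uC; have [/negPf-> _] := CP vC.
    by case: (u == v) => /=; ring.
  - have [/negPf-> _] := CP uC; case: (eqVneq u v) => [uv|_].
      by rewrite -uv uC in vC.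
    by case: (v \in S) => /=; ring.
  - have [/negPf-> _] := CP vC; case: (eqVneq u v) => [uv|_].
      by rewrite uv vC in uC.
    by case: (u \in S) => /=; ring.
  - by rewrite !andbF; case: (u \in S); case: (v \in S); case: (u == v) => /=; ring.
under eq_bigr do rewrite !big_split /=.
rewrite big_split /= !big_split /= !double_sum_mem sumrN -mulr_suml sum_mem.
by rewrite /base -/k -/N; ring.
Qed.

Let B1 := block l1.
Let B2 := [set x in B | lab x != l1].
(* A vertex v of B outside the largest block may be adjacent to the
   representative of its own block; this loss of weight c b is compensated by the
   non-adjacency of v to the largest block, which then has at least two vertices,
   as c < 2 b. *)
Let loss u v := [&& u \in C, v \in B2 & lab u == lab v].

(** Labels are injective on C, so each v in [B2] meets at most one representative of its own
    block. *)
Lemma loss_le : \sum_u \sum_v (loss u v)%:R <= #|B2|%:R :> R.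
Proof.
rewrite exchange_big -sum_mem /=; apply: ler_sum => v _.
case vB2: (v \in B2); last by rewrite big1 // => u _; rewrite /loss vB2 andbF.
have [[u0 loss_u0]|no_loss] := altP (@existsP _ (fun u => loss u v)).
  rewrite (bigD1 u0) //= loss_u0 big1 ?addr0 // => u u_neq.
  case loss_u: (loss u v) => //; case/eqP: u_neq.
  case/and3P: loss_u0 => u0C _ /eqP lab_u0; case/and3P: loss_u => uC _ /eqP lab_u.
  by apply: C_inj => //; rewrite lab_u0 lab_u.
rewrite big1 ?ler01 // => u _; move: no_loss; rewrite negb_exists => /forallP/(_ u).
by move/negPf->.
Qed.

Lemma loss_block u v : loss u v -> (1 < #|B1|)%N.
Proof.
case/and3P => uC vB2 /eqP lab_uv; apply: leq_trans (l1_max (lab v)).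
have [uS _] := CP uC; move: vB2; rewrite !inE negb_or => /andP[/andP[vS vC] _].
rewrite (cardsD1 u) (cardsD1 v) !inE uS vS lab_uv !eqxx /=.
by rewrite andbT (_ : v != u) //; apply: contraNneq vC => ->.
Qed.

(** Pairs between [B1] and [B2] are adjacent in the model but not in G. If some loss occurs, |B1| >=
    2 and c < 2 b make this gain larger than the loss; otherwise the gain alone is positive. *)
Lemma tri_form_gt : B2 != set0 ->
  base < \sum_u \sum_v (nonadj u v)%:R * (tri_weight u * tri_weight v).
Proof.
move=> B2_neq0.
have B2_gt0 : 0 < #|B2|%:R :> R by rewrite ltr0n card_gt0.
pose ell : R := \sum_u \sum_v (loss u v)%:R.
have gain : ell * (c * b) < #|B1|%:R * #|B2|%:R * b ^+ 2.
  have b2_gt0 : 0 < b ^+ 2 by rewrite exprn_gt0.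
  have [[p loss_p]|no_loss] := altP (@existsP _ (fun p => loss p.1 p.2)).
    have B1_ge2 : 2 <= #|B1|%:R :> R by rewrite ler_nat (loss_block loss_p).
    apply: le_lt_trans (_ : #|B2|%:R * (c * b) < _).
      by rewrite ler_pM2r ?loss_le // mulr_gt0.
    apply: lt_le_trans (_ : 2 * (#|B2|%:R * b ^+ 2) <= _).
      by rewrite [ltRHS]mulrCA ltr_pM2l // expr2 mulrA ltr_pM2r.
    by rewrite -mulrA ler_pM2r // mulr_gt0.
  rewrite /ell big1 => [|u _]; first by rewrite mul0r !mulr_gt0 // ltr0n.
  rewrite big1 // => v _; move: no_loss; rewrite negb_exists => /forallP/(_ (u, v)).
  by move/negPf->.
apply: lt_le_trans (_ : base - 2 * (ell * (c * b))
    + 2 * (#|B1|%:R * #|B2|%:R * b ^+ 2) <= _); first lra.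
(* Termwise lower bound: the model form, minus each loss and plus each gain, both counted in the two
   orders of the pair. *)
pose e u v : R := (tri_nonadj u v)%:R * (tri_weight u * tri_weight v)
  - (loss u v)%:R * (c * b) - (loss v u)%:R * (c * b)
  + (u \in B1)%:R * (v \in B2)%:R * b ^+ 2
  + (u \in B2)%:R * (v \in B1)%:R * b ^+ 2.
apply: le_trans (_ : \sum_u \sum_v e u v <= _).
  under [leRHS]eq_bigr do rewrite !big_split /= !sumrN.
  rewrite !big_split /= !sumrN !double_sum_mem tri_base.
  have -> : \sum_u \sum_v (loss u v)%:R * (c * b) = ell * (c * b).
    by rewrite mulr_suml; apply: eq_bigr => u _; rewrite mulr_suml.
  have -> : \sum_u \sum_v (loss v u)%:R * (c * b) = ell * (c * b).
    by rewrite exchange_big mulr_suml; apply: eq_bigr => u _; rewrite mulr_suml.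
  by lra.
apply: ler_sum => u _; apply: ler_sum => v _; rewrite /e.
have W_ge0 : 0 <= (nonadj u v)%:R * (tri_weight u * tri_weight v).
  by rewrite mulr_ge0 ?ler0n // mulr_ge0 // ltW // tri_weight_gt0.
have CS x : x \in S -> (x \in C) = false.
  by move=> xS; apply/negP => /CP[]; rewrite xS.
rewrite /tri_nonadj /loss /B2 /B1 /B /block !inE.
case uS: (u \in S); first by rewrite CS //= !andbF /=; lra.
case vS: (v \in S); first by rewrite (CS v) //= !andbF /=; lra.
have := @nonadj_lab u v; rewrite uS vS => /(_ isT isT) nadj.
move: W_ge0; rewrite /tri_weight uS vS.
case uC: (u \in C); case vC: (v \in C) => /=; rewrite ?andbT ?andbF /=.
- have [_ /negPf->] := CP uC; have [_ /negPf->] := CP vC => /=.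
  case: (eqVneq u v) => [_|u_neq_v] W_ge0 /=; first lra.
  rewrite nadj; first by rewrite /=; lra.
  by apply: contra_neq u_neq_v; apply: C_inj.
- have [_ lab_u] := CP uC; rewrite (negPf lab_u) /=.
  have -> : u != v by apply/negP => /eqP uv; rewrite -uv uC in vC.
  case: (eqVneq (lab v) l1) => [lab_v|lab_v] W_ge0 /=.
    by rewrite nadj ?lab_v //=; lra.
  by case: eqVneq nadj => [_ _|_ ->//] /=; lra.
- have [_ lab_v] := CP vC; rewrite (negPf lab_v) /=.
  have -> : u != v by apply/negP => /eqP uv; rewrite uv vC in uC.
  case: (eqVneq (lab u) l1) => [lab_u|lab_u] W_ge0 /=.
    by rewrite nadj ?lab_u 1?eq_sym //=; lra.
  by rewrite [lab v == _]eq_sym; case: eqVneq nadj => [_ _|_ ->//] /=; lra.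
- case: (eqVneq (lab u) l1) => [lab_u|lab_u];
    case: (eqVneq (lab v) l1) => [lab_v|lab_v] W_ge0 /=; try lra.
    by rewrite nadj /= ?lab_u 1?eq_sym //; lra.
  by rewrite nadj /= ?lab_v //; lra.
Qed.

(** When [B2] is empty, all of B carries the label [l1], so model non-adjacency implies
    non-adjacency in G. The forms then compare termwise, and positive weights turn equality of sums
    into equality of relations. *)
Lemma tri_form_ge :
  let W := \sum_u \sum_v (nonadj u v)%:R * (tri_weight u * tri_weight v) in
  base <= W /\ (W = base -> forall u v, nonadj u v = tri_nonadj u v).
Proof.
have [B2_0|/tri_form_gt W_gt] := eqVneq B2 set0; last first.
  by split=> [|W_eq]; [exact: ltW | rewrite W_eq ltxx in W_gt].
have term_ge0 u v : 0 <= ((nonadj u v)%:R - (tri_nonadj u v)%:R)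
    * (tri_weight u * tri_weight v).
  apply: mulr_ge0; last by rewrite mulr_ge0 // ltW ?tri_weight_gt0.
  rewrite subr_ge0 ler_nat; case tri: (tri_nonadj u v) => //.
  suff -> : nonadj u v by [].
  case/and4P: tri => uS vS u_neq_v uvC; apply: nonadj_lab => //.
  have lab_l1 x : x \notin S -> x \notin C -> lab x = l1.
    move=> xS xC; apply/eqP; apply: contraT => lab_x.
    by have := in_set0 x; rewrite -B2_0 !inE lab_x negb_or xS xC.
  case: (boolP (u \in C)) (boolP (v \in C)) => uC [] vC.
  - by apply: contra_neq u_neq_v; apply: C_inj.
  - by rewrite (lab_l1 v) //; have [] := CP uC.
  - by rewrite (lab_l1 u) // eq_sym; have [] := CP vC.
  - by rewrite (negPf uC) (negPf vC) in uvC.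
move=> W.
have W_base : W - base = \sum_u \sum_v ((nonadj u v)%:R - (tri_nonadj u v)%:R)
    * (tri_weight u * tri_weight v).
  rewrite -tri_base /W -sumrB; apply: eq_bigr => u _; rewrite -sumrB.
  by apply: eq_bigr => v _; rewrite mulrBl.
split=> [|W_eq u v].
  by rewrite -subr_ge0 W_base; do 2!apply: sumr_ge0 => ? _.
have sum0 := psumr_eq0P (fun u _ => sumr_ge0 _ (fun v _ => term_ge0 u v)).
move: W_base; rewrite W_eq subrr => /esym/sum0/(_ u isT).
move/(psumr_eq0P (fun v _ => term_ge0 u v))/(_ v isT)/eqP.
rewrite !mulf_eq0 !(gt_eqF (tri_weight_gt0 _)) !orbF subr_eq0 eqr_nat.
by case: (nonadj u v); case: (tri_nonadj u v).
Qed.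

End Tripartite.
End Cut.

(** * Recognising the extremal graph; cuts of size at least the minimum degree *)

Lemma adjE (G : sgraph) (x y : G) : adj x y = (x != y) && ~~ nonadj x y.
Proof.
rewrite /nonadj; case: eqVneq => [->|] /=; first by rewrite adj_irr.
by rewrite negbK.
Qed.

Lemma tri_nonadj_iso (G : sgraph) (S C : {set G}) (n d : nat) :
    #|G| = n -> #|S| = d -> #|C| = d.+1 -> [disjoint S & C] ->
    (forall u v, nonadj u v = tri_nonadj S C u v) ->
  graph_iso G (extremal_graph n d).
Proof.
move=> nE SE CE SC_disj nadjE; pose B := ~: (S :|: C).
have n_ge : (2 * d + 1 <= n)%N.
  have := max_card (mem (S :|: C)); rewrite cardsU nE SE CE.
  by move: SC_disj; rewrite -setI_eq0 => /eqP->; rewrite cards0; lia.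
have BE : #|B| = (n - 2 * d - 1)%N.
  have := cardsC (S :|: C); rewrite -/B cardsU nE SE CE.
  by move: SC_disj; rewrite -setI_eq0 => /eqP->; rewrite cards0; lia.
have /card_gt0P[x0 _] : (0 < #|G|)%N by rewrite nE; lia.
(* The map is built from the model, by enumerating S, B and C; the required isomorphism is its
   inverse. *)
pose g (u : extremal_graph n d) : G :=
  match u with
  | inl i => nth x0 (enum S) (nat_of_ord i)
  | inr (inl i) => nth x0 (enum B) (nat_of_ord i)
  | inr (inr i) => nth x0 (enum C) (nat_of_ord i)
  end.
have gS (i : 'I_d) : g (inl i) \in S.
  by rewrite -mem_enum mem_nth // -cardE SE.
have gB (i : 'I_(n - 2 * d - 1)) : g (inr (inl i)) \in B.
  by rewrite -mem_enum mem_nth // -cardE BE.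
have gC (i : 'I_d.+1) : g (inr (inr i)) \in C.
  by rewrite -mem_enum mem_nth // -cardE CE.
have SC x : x \in S -> (x \in C) = false by apply: disjointFr.
have CS x : x \in C -> (x \in S) = false by apply: disjointFl.
have {}gB i : (g (inr (inl i)) \in S) = false /\ (g (inr (inl i)) \in C) = false.
  by have := gB i; rewrite !inE negb_or => /andP[/negPf-> /negPf->].
have g_eq u v : (g u == g v) = (u == v).
  case: u v => [i|[i|i]] [j|[j|j]].
  - by rewrite /= nth_uniq ?enum_uniq -?cardE ?SE.
  - by apply/eqP => /= E; have := gS i; rewrite /= E (gB j).1.
  - by apply/eqP => /= E; have := SC _ (gS i); rewrite /= E gC.
  - by apply/eqP => /= E; have := gS j; rewrite /= -E (gB i).1.
  - by rewrite /= nth_uniq ?enum_uniq -?cardE ?BE.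
  - by apply/eqP => /= E; have := gC j; rewrite /= -E (gB i).2.
  - by apply/eqP => /= E; have := SC _ (gS j); rewrite /= -E gC.
  - by apply/eqP => /= E; have := gC i; rewrite /= E (gB j).2.
  - by rewrite /= nth_uniq ?enum_uniq -?cardE ?CE.
have g_adj u v : adj (g u) (g v) = adj u v.
  rewrite adjE nadjE /tri_nonadj g_eq.
  case: u v => [i|[i|i]] [j|[j|j]];
    rewrite ?gS ?gC ?(CS _ (gC _)) ?(SC _ (gS _)) ?(gB _).1 ?(gB _).2 ?orbT /= ?andbT //.
  - by rewrite andbF andbT.
  - by rewrite andbN.
have g_inj : injective g by move=> u v /eqP; rewrite g_eq => /eqP.
have /(inj_card_bij g_inj)[f gK fK] : (#|G| <= #|extremal_graph n d|)%N.
  by rewrite nE !card_sum !card_ord; lia.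
exists f; first by exists g.
by move=> x y; rewrite -g_adj !fK.
Qed.

Lemma large_cut_iso (R : realType) (G : sgraph) (T : finType) (S : {set G})
    (lab : G -> T) (n d : nat) (mu : R) :
    respects_cut S lab -> #|G| = n -> (2 <= d)%N -> (9 * d <= n)%N ->
    (d <= #|S|)%N -> (#|S| + 2 <= #|lab @: (~: S)|)%N ->
    quotient_poly mu n%:R (d%:R + 1) = 0 ->
    n%:R + 3 / 2 * (d%:R + 1) <= mu ->
    lambda1 (distance_matrix R G) + 1 <= mu ->
  graph_iso G (extremal_graph n d).
Proof.
move=> lab_cut nE d_ge2 n_ge d_le L_ge root_mu mu_ge lam_le.
set s := #|S| in d_le L_ge.
have [|l1 l1_gt0 l1_max] := @max_block _ _ S lab; first by rewrite -card_gt0; lia.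
have [|C [CE C_inj CP]] := @block_representatives _ _ S lab l1 s.+1.
  by apply: leq_trans L_ge; rewrite addn2.
have sn : (2 * s.+1 <= n)%N.
  have := leq_trans L_ge (leq_imset_card _ _); have := cardsC S.
  by rewrite -/s nE; lia.
have SC_disj : [disjoint S & C].
  by apply/pred0P => x /=; apply/negP => /andP[xS /CP[]]; rewrite xS.
pose k : R := s%:R + 1.
have BE : #|~: (S :|: C)|%:R = n%:R - 2 * k + 1 :> R.
  have -> : #|~: (S :|: C)| = (n - (2 * s + 1))%N.
    have := cardsC (S :|: C); rewrite cardsU nE -/s CE.
    by move: SC_disj; rewrite -setI_eq0 => /eqP->; rewrite cards0; lia.
  by rewrite natrB; [rewrite natrD natrM /k; ring | lia].
have kE : #|C|%:R = k by rewrite CE -natr1.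
have d_geR : 2 <= d%:R :> R by rewrite ler_nat.
have n_geR : 9 * d%:R <= n%:R :> R by rewrite -natrM ler_nat.
have k_ge : d%:R + 1 <= k by rewrite lerD2r ler_nat.
have k_n : 2 * k <= n%:R by rewrite /k natr1 -natrM ler_nat.
have k_ge1 : 1 <= k by lra.
have n_mu : n%:R <= mu by lra.
have mu_gt0 : 0 < mu by lra.
have mu_neq0 : mu != 0 by rewrite gt_eqF.
pose a := join_weight mu n%:R k; pose b := clique_weight mu.
pose c := leaf_weight mu n%:R k; pose F := weight_sum mu n%:R k.
have a_gt0 : 0 < a by rewrite divr_gt0 ?total_weight_gt0.
have b_gt0 : 0 < b by rewrite /b /clique_weight; lra.
have c_gt0 : 0 < c by apply: leaf_weight_gt0.
have c_lt : c < 2 * b by apply: leaf_clique_weight.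
have F_gt0 : 0 < F by apply: weight_sum_gt0.
pose y := tri_weight S C a b c.
have y_ge0 u : 0 <= y u by apply/ltW/tri_weight_gt0.
have G_gt0 : (0 < #|G|)%N by rewrite nE; apply: leq_trans sn.
have := distance_lambda1_ge G_gt0 y_ge0.
have sE : s%:R = k - 1 by rewrite /k addrK.
have -> : \sum_u y u = F.
  by rewrite (sum_tri a b c CP id) BE kE -/s sE.
have -> : \sum_u y u ^+ 2 = (k - 1) * a ^+ 2 + (n%:R - 2 * k + 1) * b ^+ 2 + k * c ^+ 2.
  by rewrite (sum_tri a b c CP (fun x => x ^+ 2)) BE kE -/s sE.
have [] := tri_form_ge lab_cut C_inj CP l1_gt0 l1_max a_gt0 b_gt0 c_gt0 c_lt.
rewrite -/y BE kE; set W := \sum_u _ => W_ge W_eq lam.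
move: lam W_ge W_eq; set base := (X in X <= W); set Y := (X in _ * X).
move=> lam W_ge W_eq.
have form : F ^+ 2 + base - mu * Y = F * (F - total_weight mu n%:R k).
  exact: weight_form.
have Y_ge0 : 0 <= Y.
  rewrite /Y !addr_ge0 // mulr_ge0 ?sqr_ge0 //; lra.
have lamY : (lambda1 (distance_matrix R G) + 1) * Y <= mu * Y by apply: ler_wpM2r.
have FT := weight_sumE n%:R k mu_neq0; rewrite -/F in FT.
(* If s = d, the cubic vanishes, so F = T and the bound on [lambda1] squeezes [W] down to [base]. If
   s > d, the cubic is negative, so F > T and the Rayleigh quotient exceeds [mu]. *)
have [s_le|s_gt] := leqP s d.
  have s_eq : s = d by apply/eqP; rewrite eqn_leq s_le.
  have F_T : F - total_weight mu n%:R k = 0.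
    by apply: (mulfI mu_neq0); rewrite mulr0 FT /k s_eq root_mu oppr0.
  rewrite F_T mulr0 in form.
  have {W_eq} /W_eq nadjE : W = base.
    by apply: le_anti; rewrite W_ge andbT; clear - lam lamY form; lra.
  by apply: (@tri_nonadj_iso _ S C) => //; rewrite CE s_eq.
have : 0 < F * (F - total_weight mu n%:R k).
  rewrite pmulr_rgt0 // -(pmulr_rgt0 _ mu_gt0) FT oppr_gt0.
  apply: (quotient_poly_lt0 d_geR n_geR root_mu mu_ge) => //.
  by rewrite ltrD2r ltr_nat.
by rewrite -form; clear - lam lamY W_ge; lra.
Qed.

(** * Assembling the two cases *)

Lemma min_degree_le (G : sgraph) (x : G) : (min_degree G <= degree x)%N.
Proof.
rewrite /min_degree; elim: (index_enum _) (mem_index_enum x) => //= z r IHr.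
rewrite inE big_cons geq_min => /predU1P[<-|/IHr->]; first by rewrite leqnn.
by rewrite orbT.
Qed.

(** If S were empty, labels would be preserved by every edge, hence constant on a connected
    graph. *)
Lemma connected_cut_gt0 (G : sgraph) (T : finType) (S : {set G}) (lab : G -> T) :
    connected G -> respects_cut S lab -> (1 < #|lab @: (~: S)|)%N ->
  (0 < #|S|)%N.
Proof.
move=> G_conn lab_cut; rewrite lt0n cards_eq0; apply: contraTneq => S0.
have lab_eq x y : lab x = lab y.
  have lab_closed : closed (@adj G) [pred z | lab z == lab x].
    by move=> u v uv; rewrite !inE (lab_cut u v) // S0 inE.
  by have := closed_connect lab_closed (G_conn x y); rewrite !inE eqxx => /esym/eqP.
rewrite -leqNgt; apply/card_le1P => _ /imsetP[x _ ->] l; rewrite !inE.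
apply/imsetP/eqP => [[y _ ->]|->]; first exact: lab_eq.
by exists x; rewrite ?S0 ?inE.
Qed.

Local Close Scope ring_scope.

Theorem theorem1p1 (R : realType) (delta n : nat) (G : sgraph)
  (hdelta : 2 <= delta)
  (hconn : connected G)
  (hn : #|G| = n)
  (hbound : (Num.max (9 * delta%:R)
               (delta%:R ^+ 2 / 2 + 3 * delta%:R + 3) <= n%:R :> rat)%R)
  (hdeg : min_degree G = delta)
  (hlambda : (lambda1 (distance_matrix R G) <=
              lambda1 (distance_matrix R (extremal_graph n delta)))%R) :
  tough 1 G \/ graph_iso G (extremal_graph n delta).
Proof.
have [|not_tough] := boolp.EM (tough 1 G); [by left | right].
have n_ge : 9 * delta <= n.
  by move: hbound; rewrite ge_max -natrM ler_nat => /andP[].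
have [S S_cut] := not_tough_cut not_tough.
have [T [lab [lab_cut labE]]] := component_labelling S; rewrite -labE in S_cut.
have [||mu [root_mu mu_ge mu_U1 mu_U2]] := @quotient_poly_root R delta%:R%R n%:R%R.
- by rewrite ler_nat.
- by rewrite -natrM ler_nat.
have n_mu : (n%:R <= mu)%R.
  by apply: le_trans mu_ge; rewrite lerDl; have := ler0n R delta; lra.
(* Both cases play against this bound: a small cut contradicts it, and a large one forces the
   extremal graph. *)
have lam_le : (lambda1 (distance_matrix R G) + 1 <= mu)%R.
  rewrite -lerBrDr; apply: le_trans hlambda _.
  by apply: extremal_lambda1_le => //; lia.
have [S_ge|S_lt] := leqP delta #|S|; first exact: large_cut_iso S_cut _ _ lam_le.
suff : (mu < lambda1 (distance_matrix R G) + 1)%R by rewrite ltNge lam_le.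
apply: (small_cut_lambda1 lab_cut hn hdelta n_ge) => // [u|].
  by rewrite -hdeg min_degree_le.
rewrite S_lt andbT; apply: connected_cut_gt0 hconn lab_cut _.
by apply: leq_trans S_cut; rewrite addn2.
Qed.
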